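(* For integers $n,k\ge 1$ let $$S_{n,k}(w)=\sum_{j=0}^n\binom{n+k}{j+k}w^j,\qquad \rho_{n,k}:=\max_{\beta\in Z(S_{n,k})}|\beta|.$$ For a polynomial $P\in\mathbb C[z]$ of degree $n$, let $Q$ be the unique polynomial of degree $n$, with the same leading coefficient as $P$, satisfying (this is the case $\xi=0$) $$\frac{\mathrm d^k}{\mathrm dz^k}\bigl(z^kQ(z)\bigr)=(n+1)_k\,P(z).$$ If $R>0$ and $Z(P)\subset\overline D(0,R)$, then $$Z(Q)\subset\overline D(0,R\rho_{n,k}).$$ The constant $\rho_{n,k}$ is best possible over all degree-$n$ polynomials $P$ with zeros in $\overline D(0,R)$; that is, no smaller constant in place of $\rho_{n,k}$ makes the inclusion valid for all such $P$. Moreover, $$\rho_{n,k}\le k+1,\qquad \rho_{1,k}=k+1,$$ and, for every $n\ge 1$, $$\rho_{n,1}=\begin{cases}2, & n\ \text{odd},\\ 2\cos\left(\dfrac{\pi}{2(n+1)}\right), & n\ \text{even}.\end{cases}$$ In addition, $$\rho_{2,k}=\sqrt{\frac{(k+1)(k+2)}{2}}<k+1 .$$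
   Context: $(a)_k:=a(a+1)\cdots(a+k-1)$ denotes the rising factorial. $\overline D(c,r)=\{z\in\mathbb C:|z-c|\le r\}$. $Z(F)$ denotes the set of complex zeros of a polynomial $F$. All polynomials have complex coefficients. For every $P$ of degree $n$, the polynomial $Q$ described in the claim exists and is unique. *)

(* Defs.v *)
From HB Require Import structures.
From mathcomp Require Import all_boot all_order all_algebra.
From mathcomp Require Import complex.
From mathcomp Require Import all_classical all_reals all_analysis.

Set Implicit Arguments.
Unset Strict Implicit.
Unset Printing Implicit Defensive.

Import Order.TTheory GRing.Theory Num.Theory.
Local Open Scope ring_scope.
Local Open Scope complex_scope.
Local Open Scope classical_set_scope.

(* The norm `|z| of z : R[i] lives in R[i]; this is its R-valued version. *)
Notation cabs := ComplexField.Normc.normc.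

Definition rising (a k : nat) : nat := (\prod_(i < k) (a + i))%N.

Definition cdisc (R : realType) (c : R[i]) (r : R) : set R[i] :=
  [set z | cabs (z - c) <= r].

Definition zeros (R : realType) (F : {poly R[i]}) : set R[i] :=
  [set z | root F z].

Definition zero_seq (R : realType) (F : {poly R[i]}) : seq R[i] :=
  sval (closed_field_poly_normal F).

Lemma mem_zero_seq (R : realType) (F : {poly R[i]}) (z : R[i]) :
  F != 0 -> (z \in zero_seq F) = root F z.
Proof.
move=> F0; rewrite /zero_seq; case: closed_field_poly_normal => s /= ->.
by rewrite rootZ ?lead_coef_eq0 // root_prod_XsubC.
Qed.

Definition Spoly (R : realType) (n k : nat) : {poly R[i]} :=
  \poly_(j < n.+1) ('C(n + k, j + k))%:R.

(* Since moduli are nonnegative, the default value 0 of the iterated maximum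
   is harmless when 0 < n; see rho_is_max. *)
Definition rho (R : realType) (n k : nat) : R :=
  \big[Num.max/0]_(b <- zero_seq (Spoly R n k)) cabs b.

Lemma size_Spoly (R : realType) (n k : nat) : size (Spoly R n k) = n.+1.
Proof. by rewrite size_poly_eq // binn oner_neq0. Qed.

Lemma cabs_ge0 (R : realType) (z : R[i]) : 0 <= cabs z.
Proof. by case: z => a b; exact: sqrtr_ge0. Qed.

Lemma rho_is_max (R : realType) (n k : nat) : (0 < n)%N ->
  (exists2 b, b \in zeros (Spoly R n k) & cabs b = rho R n k) /\
  (forall b, b \in zeros (Spoly R n k) -> cabs b <= rho R n k).
Proof.
move=> n0; have S0 : Spoly R n k != 0 by rewrite -size_poly_gt0 size_Spoly.
have memS b : (b \in zeros (Spoly R n k)) = (b \in zero_seq (Spoly R n k)).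
  by rewrite mem_zero_seq //; apply/idP/idP; rewrite inE.
split; last first.
  by move=> b; rewrite memS => bS; rewrite /rho; apply: le_bigmax_seq.
have [z rz] : exists z, root (Spoly R n k) z.
  by apply/closed_rootP; rewrite size_Spoly eqSS -lt0n.
suff [b bS bE] : exists2 b, b \in zero_seq (Spoly R n k) & cabs b = rho R n k.
  by exists b; rewrite ?memS.
move: rz; rewrite -mem_zero_seq // /rho.
elim: (zero_seq _) z => // a [|c s] IH z _.
  by exists a; rewrite ?mem_head // big_cons big_nil max_l // cabs_ge0.
have [b bs bE] := IH c (mem_head _ _).
rewrite big_cons -bE; have [_|_] := leP (cabs a) (cabs b).
  by exists b; rewrite // in_cons bs orbT.
by exists a; rewrite ?mem_head.
Qed.

(* derivn k is the k-th formal derivative; MathComp-Analysis shadows its usual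
   notation p^`(k). *)
Definition isQ (R : realType) (n k : nat) (P Q : {poly R[i]}) : Prop :=
  [/\ size Q = n.+1, lead_coef Q = lead_coef P &
      derivn k ('X^k * Q) = (rising n.+1 k)%:R *: P].

Definition zero_inclusion (R : realType) (n k : nat) (r c : R) : Prop :=
  forall P Q : {poly R[i]}, size P = n.+1 -> isQ n k P Q ->
    zeros P `<=` cdisc 0 r -> zeros Q `<=` cdisc 0 (r * c).

(* Main.v *)
Require Import Defs.
From HB Require Import structures.
From mathcomp Require Import all_boot all_order all_algebra.
From mathcomp Require Import complex ring lra zify.
From mathcomp Require Import all_classical all_reals all_analysis.

Import Order.TTheory GRing.Theory Num.Theory.
Local Open Scope ring_scope.

                                            

(** The map from Q to the k-th derivative of z^k Q is diagonal on monomials, and the factorial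
    identity [ffact_mul_bin] turns its normalized inverse into Q_j = P_j S_j / C(n,j) with S =
    S_{n,k}. So Q is the Schur-Szegő composition of P and S ([isQE]). In such a composition bounds
    on the moduli of zeros multiply ([szego_composition]), which is the inclusion. This comes from
    Grace's theorem for discs ([grace_apolarity]), obtained by iterating Laguerre's theorem on polar
    derivatives ([polar_deriv_roots]). The constant is sharp because P = (z+R)^n yields Q(z) = R^n
    S(z/R).

    The rest concerns the zeros of S, the polynomial part of (1+w)^(n+k) / w^k. In descending powers
    of 1+w its coefficients are C(k-1+j,j), with consecutive ratios at most k, so Eneström-Kakeya
    gives |1+w| <= k and hence |w| <= k+1. For k = 1, w S(w) = (1+w)^(n+1) - 1, and the zeros come
    from the nontrivial roots of unity. For n = 2 they form a conjugate pair, whose modulus is the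
    square root of the constant coefficient. *)

(** * Apolarity, Laguerre's theorem and Szegő composition *)

(** Grace's apolar form with the second argument reversed and the signs absorbed: pairing f with (X
    - b)^n gives (-b)^n f(-1/b) for b nonzero. A zero b of g thus stands for the point -1/b. *)
Definition apolar_pairing {F : fieldType} (n : nat) (f g : {poly F}) : F :=
  \sum_(j < n.+1) f`_j * g`_j / 'C(n, j)%:R.

                                                                                
                                                                  
(** This is -b times the polar derivative n f + (p - X) f' with pole p = -1/b. In this scaling b =
    0, the pole at infinity, gives f'. *)
Definition polar_deriv {F : fieldType} (n : nat) (b : F) (f : {poly F}) :=
  (1 + b *: 'X) * deriv f - (n%:R * b) *: f.

Lemma coef_polar_deriv {F : fieldType} (n : nat) (b : F) (f : {poly F}) j :
  (polar_deriv n b f)`_j = j.+1%:R * f`_j.+1 - b * (n%:R - j%:R) * f`_j.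
Proof.
rewrite /polar_deriv coefB mulrDl mul1r coefD -scalerAl !coefZ coefXM.
rewrite !coef_deriv; case: j => [|j] /=; ring.
Qed.

(** Up to the factor n+1, the polar derivative is adjoint to multiplication by X - b. This is what
    allows induction on the zeros of the second argument. *)
Lemma apolar_pairing_mulXsubC {F : numFieldType} (n : nat) (b : F)
    (f g : {poly F}) : (size g <= n.+1)%N ->
  n.+1%:R * apolar_pairing n.+1 f (('X - b%:P) * g) =
  apolar_pairing n (polar_deriv n.+1 b f) g.
Proof.
move=> sg.
have gn : g`_n.+1 = 0 by rewrite nth_default.
pose a j := f`_j / 'C(n.+1, j)%:R.
have -> : apolar_pairing n.+1 f (('X - b%:P) * g) =
    \sum_(j < n.+1) (a j.+1 - b * a j) * g`_j.
  under [RHS]eq_bigr do rewrite mulrBl.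
  rewrite sumrB /apolar_pairing.
  under eq_bigr => j _.
    rewrite mulrBl coefB coefXM coefCM mulrBr mulrBl.
    over.
  rewrite sumrB; congr (_ - _).
    rewrite big_ord_recl /= mulr0 mul0r add0r; apply: eq_bigr => i _.
    rewrite /a /bump /=; ring.
  rewrite big_ord_recr /= gn !mulr0 mul0r addr0; apply: eq_bigr => i _.
  rewrite /a; ring.
rewrite mulr_sumr; apply: eq_bigr => -[j /= jn] _.
have C0 m i : (i <= m)%N -> 'C(m, i)%:R != 0 :> F.
  by move=> im; rewrite pnatr_eq0 -lt0n bin_gt0.
rewrite coef_polar_deriv mulrA [RHS]mulrAC; congr (_ * _).
(* The two absorption identities convert the weights of degree n+1 into those of degree n. *)
have d1 : n.+1%:R / 'C(n.+1, j.+1)%:R = j.+1%:R / 'C(n, j)%:R :> F.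
  by apply/eqP; rewrite eqr_div ?C0 // -!natrM mul_bin_diag.
have d2 : n.+1%:R / 'C(n.+1, j)%:R = (n.+1%:R - j%:R) / 'C(n, j)%:R :> F.
  apply/eqP; rewrite eqr_div ?C0 // ?leqW // -natrB ?leqW // -!natrM.
  by rewrite -mul_bin_down.
transitivity (n.+1%:R / 'C(n.+1, j.+1)%:R * f`_j.+1
              - b * f`_j * (n.+1%:R / 'C(n.+1, j)%:R)); first by rewrite /a; ring.
by rewrite d1 d2; ring.
Qed.

Lemma horner_deriv_prod_XsubC {F : fieldType} (s : seq F) (x : F) :
  all (fun c => x != c) s ->
  (deriv (\prod_(c <- s) ('X - c%:P))).[x] =
  (\prod_(c <- s) ('X - c%:P)).[x] * \sum_(c <- s) (x - c)^-1.
Proof.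
elim: s => [_|c s IH /= /andP[xc /IH e]]; first by rewrite !big_nil derivC hornerE mulr0.
rewrite !big_cons derivM derivXsubC mul1r hornerD !hornerM e hornerXsubC.
by have := xc; rewrite -subr_eq0 => xc'; field.
Qed.

                                                                          
                                            
(** The Möbius map u -> w = (1 + b u)/(x - u) sends the disc |u| s < 1 into an open half-plane
    through 0. The rotating factor depends only on x, b and s, so sums over several u stay in that
    half-plane. *)
Lemma polar_half_plane {C : numClosedFieldType} (s b u x : C) :
  0 <= s -> `|u| * s < 1 -> `|b| <= s -> 1 <= `|x| * s -> x * b != -1 ->
  0 < 'Re ((s ^+ 2 * x + b^*) * ((1 + b * u) / (x - u))).
Proof.
move=> s0 us bs xs xb.
have xu : x - u != 0.
  by apply: contraTneq us => /subr0_eq <-; rewrite -real_leNgt ?ger0_real ?mulr_ge0.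
set w := (1 + b * u) / (x - u).
have e : x * w - 1 = u * (w + b) by rewrite /w; field.
have wb : w + b != 0.
  have -> : w + b = (1 + x * b) / (x - u) by rewrite /w; field.
  by rewrite mulf_neq0 ?invr_eq0 // addrC -[1]opprK subr_eq0.
have lt1 : s ^+ 2 * `|x * w - 1| ^+ 2 < `|w + b| ^+ 2.
  rewrite e normrM exprMn mulrA [X in X < _]mulrC -[ltRHS]mulr1.
  rewrite ltr_pM2l ?exprn_gt0 ?normr_gt0 //.
  by rewrite -exprMn mulrC expr_lte1 ?mulr_ge0.
have sr : s^* = s by apply/CrealP/ger0_real.
(* Since u = (x w - 1)/(w + b), the disc condition reads s^2 |x w - 1|^2 < |w + b|^2. Expanding it
   writes twice the real part as one positive and two nonnegative terms. *)
rewrite -(@pmulrn_lgt0 _ _ 2) // -mulr_natr [_ * _](_ : _ =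
  (`|w + b| ^+ 2 - s ^+ 2 * `|x * w - 1| ^+ 2)
  + ((`|x| * s) ^+ 2 - 1) * `|w| ^+ 2 + (s ^+ 2 - `|b| ^+ 2)); last first.
  rewrite ReE exprMn !normCK !(rmorphD, rmorphM, rmorphB, rmorphXn, rmorph1) /= sr conjCK.
  by rewrite divfK ?pnatr_eq0 //; ring.
apply: ltr_pwDl; first apply: ltr_pwDl; first by rewrite subr_gt0.
  by rewrite mulr_ge0 ?exprn_ge0 // subr_ge0 exprn_ege1.
by rewrite subr_ge0 lerXn2r ?nnegrE.
Qed.

(** Laguerre's theorem: the pole -1/b lies outside the disc |u| s < 1 containing the zeros of f, so
    the polar derivative keeps its zeros there and drops the degree by exactly one. *)
Lemma polar_deriv_roots {C : numClosedFieldType} (n : nat) (s b : C)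
    (f : {poly C}) : size f = n.+2 -> 0 <= s -> `|b| <= s ->
  (forall u, root f u -> `|u| * s < 1) ->
  size (polar_deriv n.+1 b f) = n.+1 /\
  (forall u, root (polar_deriv n.+1 b f) u -> `|u| * s < 1).
Proof.
move=> sf s0 bs fs.
have f0 : f != 0 by rewrite -size_poly_gt0 sf.
have [us fE] := closed_field_poly_normal f.
have l0 : lead_coef f != 0 by rewrite lead_coef_eq0.
have susz : size us = n.+1.
  by move: sf; rewrite fE size_scale // size_prod_XsubC => -[].
have usP u : u \in us -> `|u| * s < 1.
  by move=> h; apply: fs; rewrite fE rootZ ?root_prod_XsubC.
split.
  have co : (polar_deriv n.+1 b f)`_n != 0.
    have -> : (polar_deriv n.+1 b f)`_n =
        lead_coef f * (n.+1%:R + b * \sum_(u <- us) u).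
      have fn1 : f`_n.+1 = lead_coef f by rewrite lead_coefE sf.
      have fn : f`_n = - lead_coef f * \sum_(u <- us) u.
        have := @coefPn_prod_XsubC _ us; rewrite susz /= fE coefZ => -> //.
        by rewrite lead_coefZ (monicP (monic_prod_XsubC _ _ _)) mulr1 mulrN mulNr.
      by rewrite coef_polar_deriv fn fn1 -natrB ?subSnn //; ring.
    (* Each |b u| < 1, so the n+1 products b u cannot sum to -(n+1). *)
    rewrite mulf_neq0 //; apply/eqP => /eqP; rewrite addr_eq0 => /eqP e.
    have : `|n.+1%:R : C| < n.+1%:R.
      rewrite {1}e normrN normrM (le_lt_trans (ler_wpM2l _ (ler_norm_sum _ _ _))) //.
      rewrite mulr_sumr.
      have -> : n.+1%:R = \sum_(u <- us) 1 :> C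
        by rewrite big_const_seq count_predT susz iter_addr_0.
      rewrite big_seq [ltRHS]big_seq; apply: ltr_sum.
        by case: us susz {e fE usP} => // c us _; rewrite /= mem_head.
      move=> u /usP h; apply: le_lt_trans h; rewrite mulrC.
      by apply: ler_wpM2l.
    by rewrite normr_nat ltxx.
  apply/eqP; rewrite eqn_leq; apply/andP; split; last first.
    by rewrite ltnNge; apply: contra co => h; rewrite nth_default.
  apply/leq_sizeP => j jn; rewrite coef_polar_deriv.
  rewrite [f`_j.+1]nth_default ?sf // mulr0 sub0r.
  move: jn; rewrite leq_eqVlt => /orP[/eqP <-|jn].
    by rewrite subrr mulr0 mul0r oppr0.
  by rewrite [f`_j]nth_default ?sf // mulr0 oppr0.
move=> x; apply: contraLR.
rewrite -real_leNgt ?ger0_real ?mulr_ge0 // => xs.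
have fx : f.[x] != 0.
  by apply: contraTN xs => /fs h; rewrite -real_ltNge ?ger0_real ?mulr_ge0.
rewrite rootE /polar_deriv !hornerE.
(* At the pole itself only the term -(n+1) b f(x) survives. *)
have [xb|xb] := eqVneq (x * b) (-1).
  rewrite [b * x]mulrC xb subrr mul0r add0r oppr_eq0 !mulf_neq0 ?pnatr_eq0 //.
  by apply: contra_eq_neq xb => ->; rewrite mulr0 eq_sym oppr_eq0 oner_eq0.
have xus c : c \in us -> x != c.
  move=> h; apply: contraNneq fx => ->.
  by rewrite -rootE fE rootZ ?root_prod_XsubC.
have -> : (1 + b * x) * (deriv f).[x] - n.+1%:R * b * f.[x] =
    f.[x] * \sum_(c <- us) ((1 + b * c) / (x - c)).
  have -> : (deriv f).[x] = f.[x] * \sum_(c <- us) (x - c)^-1.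
    rewrite fE derivZ !hornerZ horner_deriv_prod_XsubC ?mulrA //.
    by apply/allP => c /xus.
  have -> : n.+1%:R * b = \sum_(u <- us) b.
    by rewrite big_const_seq count_predT susz iter_addr_0 mulr_natl.
  rewrite mulrCA [_ * f.[x]]mulrC -mulrBr mulr_sumr -sumrB; congr (_ * _).
  rewrite big_seq [RHS]big_seq; apply: eq_bigr => c /xus; rewrite -subr_eq0 => h.
  by field.
rewrite mulf_neq0 //; apply/eqP => e.
have : 0 < 'Re ((s ^+ 2 * x + b^*) * \sum_(c <- us) ((1 + b * c) / (x - c))).
  rewrite mulr_sumr raddf_sum /=.
  rewrite [ltLHS](_ : _ = \sum_(u <- us) 0); last by rewrite big1_eq.
  rewrite big_seq [ltRHS]big_seq; apply: ltr_sum.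
    by case: us susz {fE usP xus e} => // c us _; rewrite /= mem_head.
  by move=> u /usP h; exact: polar_half_plane.
by rewrite e mulr0 raddf0 ltxx.
Qed.

(** Each factor X - b moves across the pairing as a polar derivative of f, which keeps its zeros in
    the disc. After all factors are moved, a nonzero constant remains. *)
Lemma grace_apolarity {C : numClosedFieldType} (s : C) (bs : seq C)
    (f : {poly C}) : size f = (size bs).+1 -> 0 <= s ->
  (forall b, b \in bs -> `|b| <= s) -> (forall u, root f u -> `|u| * s < 1) ->
  apolar_pairing (size bs) f (\prod_(b <- bs) ('X - b%:P)) != 0.
Proof.
move=> + s0; elim: bs f => [f sf _ _|b bs IH f sf bsP fs] /=.
  rewrite /apolar_pairing big_ord1 big_nil coef1 /= bin0 divr1 mulr1.
  have : lead_coef f != 0 by rewrite lead_coef_eq0 -size_poly_gt0 sf.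
  by rewrite lead_coefE sf.
have [sp pr] := polar_deriv_roots _ _ _ _ sf s0 (bsP b (mem_head _ _)) fs.
have bsP' c : c \in bs -> `|c| <= s by move=> h; rewrite bsP // in_cons h orbT.
have := IH _ sp bsP' pr.
rewrite -apolar_pairing_mulXsubC ?size_prod_XsubC // mulf_eq0 negb_or big_cons.
by case/andP.
Qed.

Lemma szego_composition {C : numClosedFieldType} (n : nat) (r s : C)
    (f g : {poly C}) : size f = n.+1 -> size g = n.+1 -> 0 <= s ->
  (forall u, root f u -> `|u| <= r) -> (forall b, root g b -> `|b| <= s) ->
  forall z, root (\poly_(j < n.+1) (f`_j * g`_j / 'C(n, j)%:R)) z ->
  `|z| <= r * s.
Proof.
move=> sf sg s0 fr gs z.
(* Degree 0 is separate: without a zero of f nothing forces 0 <= r. *)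
have [|n0] := posnP n.
  move=> n0; subst n; rewrite rootE horner_poly big_ord1 expr0 divr1 mulr1.
  have e (h : {poly C}) : size h = 1%N -> h`_0 != 0.
    move=> sh; have : lead_coef h != 0 by rewrite lead_coef_eq0 -size_poly_gt0 sh.
    by rewrite lead_coefE sh.
  by rewrite mulf_eq0 !(negPf (e _ _)).
have r0 : 0 <= r.
  have [u /fr] : exists u, root f u by apply/closed_rootP; rewrite sf eqSS -lt0n.
  exact: le_trans.
apply: contraLR; rewrite -real_ltNge ?ger0_real ?mulr_ge0 // => rz.
have z0 : z != 0.
  by rewrite -normr_gt0 (le_lt_trans _ rz) ?mulr_ge0.
have g0 : lead_coef g != 0 by rewrite lead_coef_eq0 -size_poly_gt0 sg.
have [bs gE] := closed_field_poly_normal g.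
have sbs : size bs = n by move: sg; rewrite gE size_scale // size_prod_XsubC => -[].
(* The composition evaluated at z is the pairing of f(zX) with g. If |z| > r s, rescaling puts the
   zeros of f(zX) in the disc |u| s < 1, and Grace's theorem applies. *)
pose h := f \Po (z *: 'X).
have sh : size h = (size bs).+1.
  by rewrite size_comp_poly2 ?sf ?sbs // size_scale ?size_polyX.
have hr u : root h u -> `|u| * s < 1.
  rewrite rootE horner_comp !hornerE -rootE => /fr; rewrite normrM => zu.
  rewrite -(ltr_pM2l (x := `|z|)) ?normr_gt0 // mulr1 mulrA.
  by apply: le_lt_trans rz; rewrite ler_wpM2r.
have bss b : b \in bs -> `|b| <= s.
  by move=> bb; apply: gs; rewrite gE rootZ // root_prod_XsubC.
have := @grace_apolarity C s bs h sh s0 bss hr; rewrite sbs.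
apply: contraNN; rewrite rootE horner_poly => /eqP e.
rewrite -(mulrI_eq0 _ (mulfI g0)); apply/eqP; rewrite -e.
rewrite /apolar_pairing mulr_sumr; apply: eq_bigr => j _.
have -> : h`_j = f`_j * z ^+ j.
  rewrite /h comp_polyE coef_sum.
  transitivity (\sum_(i < size f) (if i == j :> nat then f`_j * z ^+ j else 0)).
    apply: eq_bigr => i _; rewrite coefZ exprZn coefZ coefXn eq_sym.
    by case: eqP => [->|]; rewrite ?mulr1 ?mulr0.
  by rewrite -big_mkcond /= (big_pred1_eq _ (cast_ord (esym sf) j)).
by rewrite [in RHS]gE coefZ; ring.
Qed.

                                     

                                                                              
                                     
(** * Eneström-Kakeya and binomial identities *)

Lemma enestrom_kakeya {C : numFieldType} (n : nat) (a : nat -> C) (k y : C) :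
  0 < a 0%N -> (forall j, 0 <= a j) -> 0 <= k ->
  (forall j, a j.+1 <= k * a j) ->
  \sum_(j < n.+1) a j * y ^+ (n - j) = 0 -> `|y| <= k.
Proof.
move=> a0 a_ge0 k0 ak Sy.
(* Multiplying by x - k leaves one leading term minus [rest], whose coefficients are nonnegative. At
   a root with |y| > k, the triangle inequality would then make the product at |y| nonpositive,
   while both its factors are positive. *)
pose rest x := \sum_(j < n) (k * a j - a j.+1) * x ^+ (n - j) + k * a n.
have mulE x : (x - k) * (\sum_(j < n.+1) a j * x ^+ (n - j)) =
    a 0%N * x ^+ n.+1 - rest x.
  have -> : rest x = k * (\sum_(j < n) a j * x ^+ (n - j))
      - x * (\sum_(j < n) a j.+1 * x ^+ (n - j.+1)) + k * a n.
    rewrite /rest !mulr_sumr -sumrB; congr (_ + _); apply: eq_bigr => -[j jn] _.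
    by rewrite /= -(subnSK jn) exprS; ring.
  rewrite mulrBl [in X in X - _]big_ord_recl [in X in _ - X]big_ord_recr /=.
  by rewrite subn0 subnn exprS; ring.
apply/negPn/negP; rewrite -real_ltNge ?ger0_real // => ky.
have eqy : a 0%N * y ^+ n.+1 = rest y.
  by apply/eqP; rewrite -subr_eq0 -mulE Sy mulr0.
have le_rest : a 0%N * `|y| ^+ n.+1 <= rest `|y|.
  rewrite -[a 0%N]ger0_norm // -normrX -normrM eqy.
  apply: (le_trans (ler_normD _ _)); rewrite [`|k * _|]ger0_norm ?mulr_ge0 //.
  rewrite lerD2r; apply: (le_trans (ler_norm_sum _ _ _)).
  apply: ler_sum => i _; rewrite normrM normrX ger0_norm // subr_ge0; exact: ak.
have : 0 < (`|y| - k) * (\sum_(j < n.+1) a j * `|y| ^+ (n - j)).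
  rewrite mulr_gt0 ?subr_gt0 // big_ord_recl ltr_pwDl //.
    by rewrite mulr_gt0 // exprn_gt0 // (le_lt_trans k0).
  by apply: sumr_ge0 => i _; rewrite mulr_ge0 ?exprn_ge0.
by rewrite mulE subr_gt0 => /lt_le_trans/(_ le_rest); rewrite ltxx.
Qed.

(** By Pascal's rule both sides satisfy T_(n+1) = (1+w) T_n + C(k+n+1, n+1). *)
Lemma sum_truncated_binomial {A : comNzRingType} (n k : nat) (w : A) :
  \sum_(j < n.+1) 'C(n + k.+1, j + k.+1)%:R * w ^+ j =
  \sum_(j < n.+1) 'C(k + j, j)%:R * (1 + w) ^+ (n - j).
Proof.
elim: n => [|n IH]; first by rewrite !big_ord1 addn0 add0n binn bin0.
rewrite [RHS]big_ord_recr /= subnn expr0 mulr1.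
have -> : \sum_(i < n.+1) 'C(k + i, i)%:R * (1 + w) ^+ (n.+1 - i) =
    (1 + w) * \sum_(i < n.+1) 'C(k + i, i)%:R * (1 + w) ^+ (n - i).
  rewrite mulr_sumr; apply: eq_bigr => -[i /= ilt] _.
  by rewrite subSn // exprS mulrCA.
rewrite -IH mulrDl mul1r.
under eq_bigr => j _ do rewrite addSn (addnS j) binS natrD mulrDl.
rewrite big_split /= big_ord_recr /= bin_small ?mul0r ?addr0; last by lia.
rewrite -addrA; congr (_ + _).
  by apply: eq_bigr => i _; rewrite [in RHS](addnS i).
rewrite big_ord_recl /= expr0 mulr1 addrC; congr (_ + _).
  rewrite mulr_sumr; apply: eq_bigr => i _.
  by rewrite /bump add1n addSnnS exprS mulrCA.
by rewrite add0n -(bin_sub (leq_addl k n.+1)) addnK (addnS n) (addnS k) addnC.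
Qed.

Lemma truncated_binomial_root_le {C : numFieldType} (n k : nat) (w : C) :
  \sum_(j < n.+1) 'C(n + k.+1, j + k.+1)%:R * w ^+ j = 0 ->
  `|w| <= k.+1%:R + 1.
Proof.
rewrite sum_truncated_binomial => S0.
have y : `|1 + w| <= k.+1%:R.
  apply: (@enestrom_kakeya _ n (fun j => 'C(k + j, j)%:R)) S0 => //.
    by rewrite bin0.
  (* The ratio of consecutive coefficients is (k+j+1)/(j+1), at most k+1. *)
  move=> j; rewrite -natrM ler_nat -(leq_pmul2l (ltn0Sn j)).
  rewrite addnS -mul_bin_diag /= mulnA leq_mul2r; apply/orP; right; nia.
have -> : w = (1 + w) - 1 by ring.
by rewrite (le_trans (ler_normB _ _)) // normr1 lerD2r.
Qed.

(** Multiplied by j! (n-j)!, both sides equal (n+k)! (k+j)^_k j! / (j+k)! = (n+k)!. *)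
Lemma ffact_mul_bin (n k j : nat) : (j <= n)%N ->
  ('C(n + k, j + k) * (k + j) ^_ k = (n + k) ^_ k * 'C(n, j))%N.
Proof.
move=> jn.
have h1 : ('C(n + k, j + k) * ((j + k)`! * (n - j)`!) = (n + k)`!)%N.
  by rewrite -(subnDr k n j) bin_fact // leq_add2r.
have h2 := bin_fact jn.
have h3 : ((k + j) ^_ k * j`! = (j + k)`!)%N.
  by rewrite addnC -[in j`!](addnK k j) ffact_fact // leq_addl.
have h4 : ((n + k) ^_ k * n`! = (n + k)`!)%N.
  by rewrite -[in n`!](addnK k n) ffact_fact // leq_addl.
apply/eqP; rewrite -(eqn_pmul2r (fact_gt0 j)) -(eqn_pmul2r (fact_gt0 (n - j))); apply/eqP.
transitivity ((n + k)`!)%N; first by rewrite -h1 -h3; ring.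
by rewrite -h4 -h2; ring.
Qed.

                                      

Local Open Scope complex_scope.
Local Open Scope classical_set_scope.

(** * Q as a composition; the inclusion and its sharpness *)

Lemma risingS_ffact (n k : nat) : rising n.+1 k = ((n + k) ^_ k)%N.
Proof.
rewrite /rising; elim: k => [|k IH]; first by rewrite big_ord0 ffactn0.
by rewrite big_ord_recr IH /= addnS ffactSS mulnC addSn.
Qed.

Lemma coef_derivn_mulXn {R : comNzRingType} (k j : nat) (p : {poly R}) :
  (derivn k ('X^k * p))`_j = p`_j *+ (k + j) ^_ k.
Proof. by rewrite coef_derivn coefXnM ltnNge leq_addr /= addKn. Qed.

Section RealType.
Context {R : realType}.
Implicit Types (P Q : {poly R[i]}) (n k : nat).

Lemma lec_cabs (z : R[i]) (r : R) : (`|z| <= r%:C) = (cabs z <= r).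
Proof. by rewrite normc_def; case: z => a b; rewrite lecR. Qed.

Lemma cabs_real (x : R) : cabs x%:C = `|x|.
Proof. by rewrite /= expr0n addr0 sqrtr_sqr. Qed.

Lemma zerosP (F : {poly R[i]}) z : zeros F z <-> root F z.
Proof. by []. Qed.

Lemma cdisc0P (r : R) z : cdisc 0 r z <-> cabs z <= r.
Proof. by rewrite /cdisc /= subr0. Qed.

(** Compare coefficients: the operator scales Q_j by the nonzero number (k+j)^_k. The closed form
    gives both existence and uniqueness of Q. *)
Lemma isQE n k P Q : size P = n.+1 ->
  isQ n k P Q <-> Q = \poly_(j < n.+1) (P`_j * (Spoly R n k)`_j / 'C(n, j)%:R).
Proof.
move=> sP.
have coefE j : (j < n.+1)%N ->
    (P`_j * (Spoly R n k)`_j / 'C(n, j)%:R) *+ (k + j) ^_ k =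
    (rising n.+1 k)%:R * P`_j.
  move=> jn; rewrite coef_poly jn risingS_ffact -mulr_natr.
  have C0 : 'C(n, j)%:R != 0 :> R[i] by rewrite pnatr_eq0 -lt0n bin_gt0.
  apply: (mulIf C0); transitivity (P`_j * ('C(n + k, j + k) * (k + j) ^_ k)%:R).
    by rewrite natrM; field.
  by rewrite (ffact_mul_bin n k j jn) natrM; ring.
split=> [[sQ _ dQ]|->].
  apply/polyP => j; rewrite coef_poly; case: ltnP => jn; last first.
    by rewrite nth_default ?sQ.
  have f0 : ((k + j) ^_ k)%:R != 0 :> R[i].
    by rewrite pnatr_eq0 -lt0n ffact_gt0 leq_addr.
  apply: (mulIf f0); rewrite !mulr_natr coefE // -coefZ -dQ.
  by rewrite coef_derivn_mulXn.
have lead : P`_n * (Spoly R n k)`_n / 'C(n, n)%:R = lead_coef P.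
  by rewrite coef_poly ltnSn !binn divr1 mulr1 lead_coefE sP.
have lead0 : lead_coef P != 0 by rewrite lead_coef_eq0 -size_poly_gt0 sP.
split; first by rewrite size_poly_eq ?lead.
  by rewrite lead_coef_poly ?lead.
apply/polyP => j; rewrite coef_derivn_mulXn coefZ coef_poly.
case: ltnP => jn; first exact: coefE.
by rewrite [P`_j]nth_default ?sP // mul0rn mulr0.
Qed.

Lemma rho_max n k : (0 < n)%N ->
  (exists2 b, root (Spoly R n k) b & cabs b = rho R n k) /\
  (forall b, root (Spoly R n k) b -> cabs b <= rho R n k).
Proof.
move=> n0; have [[b bS bE] h] := rho_is_max R k n0; split.
  by exists b => //; move: bS; rewrite inE.
by move=> c cS; apply: h; rewrite inE.
Qed.

Lemma rho_ge0 n k : (0 < n)%N -> 0 <= rho R n k.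
Proof. by case/(rho_max n k) => -[b _ <-] _; exact: cabs_ge0. Qed.

Lemma rhoE n k (b : R[i]) (r : R) : (0 < n)%N -> root (Spoly R n k) b ->
  cabs b = r -> (forall c, root (Spoly R n k) c -> cabs c <= r) -> rho R n k = r.
Proof.
move=> n0 rb bE le_r; have [[c rc cE] le_rho] := rho_max n k n0.
by apply/le_anti; rewrite -{1}cE le_r //= -bE le_rho.
Qed.

Lemma horner_Spoly n k (w : R[i]) :
  (Spoly R n k).[w] = \sum_(j < n.+1) 'C(n + k, j + k)%:R * w ^+ j.
Proof. by rewrite horner_poly. Qed.

Lemma Spoly_root_le n k (w : R[i]) : (0 < k)%N ->
  root (Spoly R n k) w -> cabs w <= k%:R + 1.
Proof.
case: k => // k _; rewrite rootE horner_Spoly => /eqP/truncated_binomial_root_le.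
by rewrite -lec_cabs rmorphD rmorph1 rmorph_nat.
Qed.

Lemma zero_inclusion_rho n k (r : R) : (0 < n)%N -> 0 < r ->
  zero_inclusion n k r (rho R n k).
Proof.
move=> n0 r0 P Q sP /isQE -> // ZP z /zerosP rz; apply/cdisc0P.
rewrite -lec_cabs rmorphM /=; apply: szego_composition rz => //.
- exact: size_Spoly.
- by rewrite lecR rho_ge0.
- by move=> u /ZP /cdisc0P; rewrite lec_cabs.
- by move=> b rb; rewrite lec_cabs; case: (rho_max n k n0) => _; apply.
Qed.

Lemma zero_inclusion_sharp n k (r c : R) : (0 < n)%N -> 0 < r ->
  c < rho R n k -> ~ zero_inclusion n k r c.
Proof.
move=> n0 r0 cr incl.
have [[b rb bE] _] := rho_max n k n0.
(* The binomial coefficients of (z+r)^n cancel the weights, so Q(z) = r^n S(z/r) vanishes at r b,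
   with b a zero of S of largest modulus. *)
pose P : {poly R[i]} := ('X - (- r%:C)%:P) ^+ n.
have sP : size P = n.+1 by rewrite size_exp_XsubC.
have PE j : (j < n.+1)%N -> P`_j = 'C(n, j)%:R * r%:C ^+ (n - j).
  move=> jn; rewrite /P polyCN opprK addrC exprDn coef_sum.
  rewrite (bigD1 (Ordinal jn)) //= -polyC_exp coefMn coefCM coefXn eqxx mulr1.
  rewrite big1 ?addr0 ?mulr_natl // => i /eqP ij.
  rewrite -polyC_exp coefMn coefCM coefXn; case: eqP => [e|_].
    by case: ij; apply: val_inj.
  by rewrite mulr0 mul0rn.
have ZP : zeros P `<=` cdisc 0 r.
  move=> z /zerosP; rewrite /P -(prednK n0) root_exp_XsubC => /eqP ->; apply/cdisc0P.
  by rewrite -rmorphN cabs_real normrN (ger0_norm (ltW r0)).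
have iQ := (isQE n k P _ sP).2 erefl.
have rC : cabs r%:C = r by rewrite cabs_real gtr0_norm.
suff /(incl _ _ sP iQ ZP)/cdisc0P :
    zeros (\poly_(j < n.+1) (P`_j * (Spoly R n k)`_j / 'C(n, j)%:R)) (r%:C * b).
  by rewrite ComplexField.Normc.normcM rC bE ler_pM2l // leNgt cr.
apply/zerosP; rewrite rootE horner_poly; apply/eqP.
transitivity (r%:C ^+ n * (Spoly R n k).[b]); last by rewrite (rootP rb) mulr0.
rewrite horner_Spoly mulr_sumr; apply: eq_bigr => -[j /= jn] _.
rewrite PE // coef_poly jn exprMn -[in r%:C ^+ n](@subnK j n jn) exprD.
have C0 : 'C(n, j)%:R != 0 :> R[i] by rewrite pnatr_eq0 -lt0n bin_gt0.
by field.
Qed.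

(** * Exact values for n = 1 and n = 2 *)

Lemma rho1 k : rho R 1 k = k%:R + 1.
Proof.
have S1 w : root (Spoly R 1 k) w = (w == - (k%:R + 1)).
  rewrite rootE horner_Spoly big_ord_recl big_ord1 /= add0n !add1n binSn binn.
  by rewrite expr0 expr1 mulr1 mul1r natr1 addrC addr_eq0.
have c1 : cabs (- (k%:R + 1) : R[i]) = k%:R + 1.
  have -> : - (k%:R + 1) = (- (k%:R + 1))%:C :> R[i].
    by rewrite rmorphN rmorphD rmorph_nat rmorph1.
  by rewrite cabs_real normrN ger0_norm // addr_ge0.
apply: (rhoE _ _ _ _ _ _ c1) => // [|c]; first by rewrite S1.
by rewrite S1 => /eqP ->; rewrite c1.
Qed.

Lemma root_Spoly2 k (a b : R) : (0 < k)%N -> root (Spoly R 2 k) (a +i* b) ->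
  cabs (a +i* b) = Num.sqrt ((k%:R + 1) * (k%:R + 2) / 2).
Proof.
move=> kgt0.
set p : R := (k%:R + 1) * (k%:R + 2) / 2.
have e0 : 'C(2 + k, 0 + k)%:R = p%:C :> R[i].
  rewrite -(rmorph_nat (real_complex R)); congr _%:C.
  have -> : 'C(2 + k, 0 + k) = 'C(k.+2, 2)
    by rewrite add0n -(bin_sub (leq_addl 2 k)) addnK.
  have : ('C(k.+2, 2) * 2)%N = (k.+2 * k.+1)%N
    by have := bin_ffact k.+2 2; rewrite ffactnS ffactn1.
  move=> /(congr1 (fun m => m%:R : R));
  rewrite !natrM /p -[k.+2%:R]natr1 -[k.+1%:R]natr1 => e.
  by apply: (@mulIf _ 2); rewrite ?pnatr_eq0 // e; field.
have e1 : 'C(2 + k, 1 + k)%:R = (k%:R + 2)%:C :> R[i].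
  by rewrite binSn rmorphD !rmorph_nat -natrD addn2.
rewrite rootE horner_Spoly !big_ord_recr big_ord0 /= e0 e1 binn.
rewrite add0r expr0 expr1 mulr1 mul1r expr2 => /eqP e.
have k0 : 0 <= k%:R :> R by [].
have re : p + (k%:R + 2) * a + (a * a - b * b) = 0.
  by have /= <- := congr1 (@complex.Re R) e; ring.
have im : b * (k%:R + 2 + 2 * a) = 0.
  by have /= <- := congr1 (@complex.Im R) e; ring.
rewrite /=; congr Num.sqrt.
(* A real root is impossible, as the discriminant is -k(k+2) < 0. Otherwise a = -(k+2)/2, and the
   real part gives a^2 + b^2 = p. *)
move/eqP: im; rewrite mulf_eq0 => /orP[]/eqP h.
  have : (2 * a + (k%:R + 2)) ^+ 2 = - (k%:R * (k%:R + 2)).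
    by move: re; rewrite h /p => re; nra.
  have kp : 0 < k%:R * (k%:R + 2) :> R by rewrite mulr_gt0 ?ltr0n ?ltr_wpDl.
  by move=> sq; have := sqr_ge0 (2 * a + (k%:R + 2)); rewrite sq oppr_ge0 leNgt kp.
have ha : a = - (k%:R + 2) / 2 by lra.
by move: re; rewrite ha; lra.
Qed.

Lemma rho2 k : (0 < k)%N ->
  rho R 2 k = Num.sqrt ((k%:R + 1) * (k%:R + 2) / 2).
Proof.
move=> k0; have [[[a b] rb <-] _] := rho_max 2 k isT.
exact: root_Spoly2.
Qed.

(** * Exact values for k = 1, through roots of unity *)

Lemma mulX_Spoly1 n (w : R[i]) :
  w * (Spoly R n 1).[w] = (1 + w) ^+ n.+1 - 1.
Proof.
rewrite exprDn big_ord_recl /= bin0 expr0 expr1n mulr1 addrAC subrr add0r.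
rewrite horner_Spoly mulr_sumr; apply: eq_bigr => i _.
by rewrite expr1n mul1r /bump add1n !addn1 mulrCA -exprS mulr_natl.
Qed.

Lemma root_Spoly1 n (w : R[i]) :
  root (Spoly R n 1) w = (w != 0) && ((1 + w) ^+ n.+1 == 1).
Proof.
rewrite rootE; have [->|w0] := eqVneq w 0.
  rewrite horner_coef0 coef_poly /= add0n addn1 bin1.
  by apply/negbTE; rewrite pnatr_eq0.
by rewrite -[_ == 1]subr_eq0 -mulX_Spoly1 mulf_eq0 (negPf w0).
Qed.

Lemma moivre (t : R) (m : nat) :
  (cos t +i* sin t) ^+ m = (cos (m%:R * t) +i* sin (m%:R * t)) :> R[i].
Proof.
elim: m => [|m IH]; first by rewrite expr0 mul0r cos0 sin0.
rewrite exprS IH -[m.+1%:R]natr1 mulrDl mul1r cosD sinD.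
by apply/eqP; rewrite eq_complex /=; apply/andP; split; apply/eqP; ring.
Qed.

Lemma rho_odd_1 n : odd n -> rho R n 1 = 2.
Proof.
move=> n1; have n0 : (0 < n)%N by case: n n1.
have c2 : cabs (- 2 : R[i]) = 2.
  have -> : - 2 = (- 2)%:C :> R[i] by rewrite rmorphN rmorph_nat.
  by rewrite cabs_real normrN normr_nat.
apply: (rhoE _ _ _ _ n0 _ c2) => [|c /Spoly_root_le]; last first.
  by rewrite -[1%:R]/1; apply.
(* For n odd, -1 is an (n+1)-th root of unity, so w = -2 attains the general bound k+1 = 2. *)
rewrite root_Spoly1 oppr_eq0 pnatr_eq0 /=.
have -> : 1 + - 2 = -1 :> R[i] by ring.
by rewrite -signr_odd /= n1.
Qed.

(** A larger real part means an angle [th] < pi/N, so N [th] lies in [0, pi) and its cosine cannot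
    be -1. The sign of the imaginary part is irrelevant, cosine being even. *)
Lemma root_oppr1_Re_le (N : nat) (c s : R) : (0 < N)%N ->
  (c +i* s) ^+ N = -1 -> c ^+ 2 + s ^+ 2 = 1 /\ c <= cos (pi / N%:R).
Proof.
move=> N0 e.
have NR : 0 < N%:R :> R by rewrite ltr0n.
have pi0 := pi_gt0 R.
have cs : c ^+ 2 + s ^+ 2 = 1.
  have : `|c +i* s| = 1.
    apply/eqP; rewrite -(@pexpr_eq1 _ _ N) // -normrX e.
    by rewrite normrN normr1.
  rewrite normc_def /= => -[] /(congr1 (fun x => x ^+ 2)).
  by rewrite sqr_sqrtr ?addr_ge0 ?sqr_ge0 // expr1n.
split=> //; rewrite leNgt; apply/negP => lt_c.
have c1 : -1 <= c <= 1 by have s2 := sqr_ge0 s; apply/andP; split; nra.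
pose th := acos c.
have th0 : 0 <= th by exact: acos_ge0.
have thpi : th <= pi by exact: acos_lepi.
have cth : cos th = c by apply: acosK; rewrite in_itv.
have piN : 0 <= (pi / N%:R : R) <= pi.
  rewrite divr_ge0 ?pi_ge0 //= ler_pdivrMr // ler_peMr ?pi_ge0 //.
  by rewrite ler1n.
have lt_th : th < pi / N%:R.
  by rewrite -ltr_cos ?in_itv /= ?th0 ?thpi ?piN // cth.
have cN : cos (N%:R * th) = -1.
  have : (s == sin th) || (s == - sin th).
    rewrite -eqf_sqr; apply/eqP.
    by move: (cos2Dsin2 th); rewrite cth => h; lra.
  case/orP=> /eqP sE.
    by move: e; rewrite sE -cth moivre => -[].
  move: e; rewrite sE -cth -cosN -sinN moivre => -[].
  by rewrite mulrN cosN.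
have ltN : N%:R * th < pi by rewrite mulrC -ltr_pdivlMr.
have : cos pi < cos (N%:R * th).
  by rewrite ltr_cos ?in_itv /= ?lexx ?pi_ge0 ?(ltW ltN) ?mulr_ge0.
by rewrite cN cospi ltxx.
Qed.

(** Put w = -(1+v). For n even, (1+w)^(n+1) = 1 means v^(n+1) = -1, and |w|^2 = 2 + 2 Re v is
    largest at v = exp(i pi/(n+1)). The half-angle formula gives the value. *)
Lemma rho_even_1 n : (0 < n)%N -> ~~ odd n ->
  rho R n 1 = 2 * cos (pi / (2 * (n%:R + 1))).
Proof.
move=> n0 n2; set u := pi / _.
have pi0 := pi_gt0 R.
have uE : u *+ 2 = pi / n.+1%:R.
  by rewrite /u -[n.+1%:R]natr1 -mulr_natr; field; rewrite natr1 pnatr_eq0.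
have cu : 0 < cos u.
  apply: cos_gt0_pihalf; apply/andP; split.
    rewrite (@lt_le_trans _ _ 0) ?oppr_lt0 ?divr_gt0 // divr_ge0 ?ltW //.
  rewrite /u ltr_pM2l // ltf_pV2 ?posrE ?mulr_gt0 //; last first.
  by rewrite ltr_pMr // ltrDr ltr0n.
have cabsE (c s : R) : c ^+ 2 + s ^+ 2 = 1 ->
    cabs (- (1 + (c +i* s))) = Num.sqrt (2 + 2 * c).
  move=> cs; rewrite /=; congr Num.sqrt.
  by lra.
have bE : 2 * cos u = Num.sqrt (2 + 2 * cos (pi / n.+1%:R)).
  rewrite -[LHS]ger0_norm ?mulr_ge0 ?ltW // -sqrtr_sqr -uE cos_mulr2n.
  by congr Num.sqrt; ring.
pose t : R := pi / n.+1%:R.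
have cb : cabs (- (1 + (cos t +i* sin t))) = 2 * cos u.
  by rewrite cabsE ?cos2Dsin2 // bE.
apply: (rhoE _ _ _ _ n0 _ cb) => [|[a b]].
  rewrite root_Spoly1; apply/andP; split.
    apply/eqP => h; move: cb; rewrite h ComplexField.Normc.normc0 => /esym/eqP.
    by rewrite mulf_eq0 pnatr_eq0 /= gt_eqF.
  rewrite opprD addrA subrr add0r exprNn moivre /t mulrCA divff ?pnatr_eq0 //.
  rewrite mulr1 cospi sinpi -signr_odd /= n2 /= expr1 mulN1r eq_complex /=.
  by rewrite opprK oppr0 !eqxx.
rewrite root_Spoly1 => /andP[_ /eqP e].
have e' : ((-1 - a) +i* (- b)) ^+ n.+1 = -1 :> R[i].
  have -> : ((-1 - a) +i* (- b)) = - (1 + (a +i* b)) :> R[i].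
    by apply/eqP; rewrite eq_complex /= opprD add0r !eqxx.
  by rewrite exprNn e mulr1 -signr_odd /= n2 expr1.
have [cs cle] := root_oppr1_Re_le _ _ _ (ltn0Sn n) e'.
have -> : a +i* b = - (1 + ((-1 - a) +i* (- b))) :> R[i].
  by apply/eqP; rewrite eq_complex /=; apply/andP; split; apply/eqP; ring.
rewrite cabsE // bE ler_wsqrtr // lerD2l ler_pM2l //.
Qed.

End RealType.

Theorem corollary3p5 (R : realType) :
  (forall n k : nat, (0 < n)%N -> (0 < k)%N ->
    [/\ forall P : {poly R[i]}, size P = n.+1 ->
          exists! Q : {poly R[i]}, isQ n k P Q,
        forall r : R, 0 < r -> zero_inclusion n k r (rho R n k),
        forall r c : R, 0 < r -> c < rho R n k -> ~ zero_inclusion n k r c &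
        rho R n k <= k%:R + 1]) /\
  (forall k : nat, (0 < k)%N -> rho R 1 k = k%:R + 1) /\
  (forall n : nat, (0 < n)%N ->
    rho R n 1 = if odd n then 2 else 2 * cos (pi / (2 * (n%:R + 1)))) /\
  (forall k : nat, (0 < k)%N ->
    rho R 2 k = Num.sqrt ((k%:R + 1) * (k%:R + 2) / 2) /\
    Num.sqrt ((k%:R + 1) * (k%:R + 2) / 2) < k%:R + 1 :> R).
Proof.
split=> [n k n0 k0|].
  split=> [P sP|r r0|r c r0 cr|].
  - exists (\poly_(j < n.+1) (P`_j * (Spoly R n k)`_j / 'C(n, j)%:R)).
    by split=> [|Q /isQE ->]; first exact/isQE.
  - exact: zero_inclusion_rho.
  - exact: zero_inclusion_sharp.
  - by have [[b rb <-] _] := @rho_max R n k n0; exact: Spoly_root_le rb.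
split=> [k _|]; first exact: rho1.
split=> [n n0|k k0].
  by case: ifP => n1; [exact: rho_odd_1|apply: rho_even_1; rewrite ?n1].
split; first exact: rho2.
have kR : 0 < k%:R :> R by rewrite ltr0n.
rewrite -[ltRHS]ger0_norm ?addr_ge0 // -sqrtr_sqr ltr_sqrt ?exprn_gt0 ?ltr_wpDl //.
by nra.
Qed.
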